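(* Let $\mathcal{M}=(\mathcal{E},\mathcal{I})$ be a matroid with weights $w\in\mathbb{R}_+^{\mathcal{E}}$, and let $p\in(0,1)$. The random set of improving elements with parameter $p$ is $\frac1p$-uncontentious.
   Context: Weights are assumed distinct. For $A\subseteq\mathcal{E}$, $\mathrm{rank}_w(A)$ is the maximum weight of an independent subset of $A$. The random set $R$ of improving elements with parameter $p$ is sampled as follows: let $S$ contain each element of $\mathcal{E}$ independently with probability $p$, and let $R=\{i\in\mathcal{E}:\mathrm{rank}_w(S\cup\{i\})>\mathrm{rank}_w(S)\}$ (equivalently, the elements of $\mathcal{E}\setminus S$ not spanned by higher-weight elements of $S$). A random set $R$ is $\alpha$-uncontentious if there is a randomized map $\phi$ from subsets of $\mathcal{E}$ to independent sets with $\phi(R)\subseteq R$ and $\Pr[i\in R]\le\alpha\Pr[i\in\phi(R)]$ for all $i\in\mathcal{E}$. *)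

(* Defs.v *)
From mathcomp Require Import all_boot all_order all_algebra.

Set Implicit Arguments.
Unset Strict Implicit.
Unset Printing Implicit Defensive.

Import Order.TTheory GRing.Theory Num.Theory.
Local Open Scope ring_scope.

Record matroid (E : finType) := Matroid {
  indep : {set {set E}};
  indep0 : set0 \in indep;
  indepS : forall A B : {set E}, A \subset B -> B \in indep -> A \in indep;
  indep_augment : forall A B : {set E},
    A \in indep -> B \in indep -> (#|A| < #|B|)%N ->
    exists2 x, x \in B :\: A & x |: A \in indep
}.

(* Probability mass functions on finite types are enough here: every random
   object ranges over {set E} for a finite ground set E. *)
Record fdist (R : realFieldType) (T : finType) := FDist {
  pmf :> T -> R;
  pmf_ge0 : forall x, 0 <= pmf x;
  pmf_sum1 : \sum_x pmf x = 1
}.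

Definition Prob (R : realFieldType) (T : finType) (d : fdist R T)
    (X : pred T) : R :=
  \sum_(x | X x) d x.

Section Pushforward.
Variables (R : realFieldType) (T U : finType) (d : fdist R T) (f : T -> U).

Let map_pmf (y : U) : R := Prob d (fun x => f x == y).

Fact map_pmf_ge0 y : 0 <= map_pmf y.
Proof. by apply: sumr_ge0 => x _; apply: pmf_ge0. Qed.

Fact map_pmf_sum1 : \sum_y map_pmf y = 1.
Proof. by rewrite -(pmf_sum1 d) (partition_big f xpredT). Qed.

Definition fdist_map : fdist R U := FDist map_pmf_ge0 map_pmf_sum1.
End Pushforward.

(* The law of k(X) for X distributed as d, where the internal randomness of
   the randomized map k is independent of X. *)
Section Bind.
Variables (R : realFieldType) (T U : finType).
Variables (d : fdist R T) (k : T -> fdist R U).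

Let bind_pmf (y : U) : R := \sum_x d x * k x y.

Fact bind_pmf_ge0 y : 0 <= bind_pmf y.
Proof. by apply: sumr_ge0 => x _; rewrite mulr_ge0 ?pmf_ge0. Qed.

Fact bind_pmf_sum1 : \sum_y bind_pmf y = 1.
Proof.
rewrite /bind_pmf exchange_big /= -(pmf_sum1 d); apply: eq_bigr => x _.
by rewrite -mulr_sumr pmf_sum1 mulr1.
Qed.

Definition fdist_bind : fdist R U := FDist bind_pmf_ge0 bind_pmf_sum1.
End Bind.

Section RandomSubset.
Variables (R : realFieldType) (E : finType) (p : R) (p01 : 0 < p < 1).

Let subset_pmf (S : {set E}) : R := \prod_e (if e \in S then p else 1 - p).

Fact subset_pmf_ge0 S : 0 <= subset_pmf S.
Proof.
case/andP: p01 => p0 p1; apply: prodr_ge0 => e _.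
by case: ifP => _; rewrite ?subr_ge0 ltW.
Qed.

Fact subset_pmf_sum1 : \sum_S subset_pmf S = 1.
Proof.
rewrite /subset_pmf.
rewrite -[LHS](bigA_distr _ _ (fun=> p) (fun=> 1 - p)) big1 // => e _ /=.
by rewrite addrC subrK.
Qed.

Definition random_subset : fdist R {set E} :=
  FDist subset_pmf_ge0 subset_pmf_sum1.
End RandomSubset.

Section Improving.
Variables (R : realFieldType) (E : finType) (M : matroid E) (w : E -> R).

(* The default value 0 of the maximum is harmless: it is the weight of the
   empty set, which is always an independent subset of A. *)
Definition wrank (A : {set E}) : R :=
  \big[Num.max/0]_(B in indep M | B \subset A) \sum_(e in B) w e.

Definition improving (S : {set E}) : {set E} :=
  [set i | wrank S < wrank (i |: S)].

Definition random_improving (p : R) (p01 : 0 < p < 1) : fdist R {set E} :=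
  fdist_map (random_subset E p01) improving.
End Improving.

(* [d] is the law of the random set, and [phi A] the law of the image of the
   set A under the randomized map. *)
Definition uncontentious (R : realFieldType) (E : finType) (M : matroid E)
    (alpha : R) (d : fdist R {set E}) : Prop :=
  exists phi : {set E} -> fdist R {set E},
    (forall A B, 0 < phi A B -> B \in indep M /\ B \subset A) /\
    (forall i : E,
       Prob d (fun A => i \in A)
         <= alpha * Prob (fdist_bind d phi) (fun B => i \in B)).

(* Main.v *)
(* Call an element of positive weight a candidate if it is not spanned by the
   heavier elements of the sample S (elements of weight 0 never improve). The set
   C of candidates splits into the improving elements R = C :\: S and an optimal
   independent subset C :&: S of S. Fix F. Whether i belongs to the greedy basis
   of C :&: F (heaviest elements first) depends only on the coins of elements
   heavier than i, so this basis keeps a fraction 1 - p of its expected size in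
   R; it is at least as large as the independent set C :&: S :&: F, so
     E rank(R :&: F) >= (1 - p) E |C :&: S :&: F| = p E |R :&: F|.
   Decomposing arbitrary weights u >= 0 into level sets, the u-greedy basis of R
   has expected u-weight at least p E u(R). By LP duality, a mixture of such
   greedy choices is good for all elements simultaneously. *)
Require Import Defs.
From mathcomp Require Import all_boot all_order all_algebra.
From mathcomp Require Import reals.
Import Order.TTheory GRing.Theory Num.Theory.
Local Open Scope ring_scope.

Set Implicit Arguments.
Unset Strict Implicit.
Unset Printing Implicit Defensive.

(** * Matroid rank, bases and the greedy basis *)

Section MatroidRank.
Variables (E : finType) (M : matroid E).
Implicit Types (A B I J X Y : {set E}) (i x : E).

Definition mrank X : nat := \max_(B in indep M | B \subset X) #|B|.

Definition is_basis X I := [&& I \in indep M, I \subset X & #|I| == mrank X].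

(** Non-membership in the matroid closure of [X], stated by rank alone. *)
Definition unspanned X i := (mrank X < mrank (i |: X))%N.

Lemma card_le_mrank X I :
  I \in indep M -> I \subset X -> (#|I| <= mrank X)%N.
Proof.
by move=> iI sIX; apply: (@leq_bigmax_cond _ _ (fun B => #|B|)); rewrite iI.
Qed.

(** An inclusion-maximal independent set between [I] and [X] already has maximum size, since any
    larger one would augment it. *)
Lemma basis_extend X I : I \in indep M -> I \subset X ->
  exists2 J, is_basis X J & I \subset J.
Proof.
move=> iI sIX.
have [|J /maxsetP[/andP[iJ sJX] maxJ] sIJ] :=
  @maxset_exists E (fun J => (J \in indep M) && (J \subset X)) I.
  by rewrite iI.
exists J => //; apply/and3P; split=> //.
rewrite eqn_leq card_le_mrank //=; apply/bigmax_leqP => B /andP[iB sBX].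
rewrite leqNgt; apply/negP => /(indep_augment iJ iB)[x].
rewrite inE => /andP[xNJ xB] ixJ.
have /setP/(_ x) : x |: J = J.
  apply: maxJ; last exact: subsetUr.
  by rewrite ixJ subUset sub1set (subsetP sBX).
by rewrite !inE eqxx (negPf xNJ).
Qed.

Lemma basis_exists X : exists I, is_basis X I.
Proof.
by have [J ? _] := basis_extend (indep0 M) (sub0set X); exists J.
Qed.

Lemma mrankS X Y : X \subset Y -> (mrank X <= mrank Y)%N.
Proof.
have [I /and3P[iI sIX /eqP <-]] := basis_exists X.
by move=> sXY; apply: card_le_mrank => //; apply: subset_trans sXY.
Qed.

Lemma unspanned_notin X i : unspanned X i -> i \notin X.
Proof.
rewrite /unspanned; apply: contraL => iX.
by rewrite (setUidPr _) ?sub1set // ltnn.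
Qed.

Lemma unspanned_indepU X I i :
  is_basis X I -> unspanned X i -> i |: I \in indep M.
Proof.
move=> /and3P[iI sIX /eqP cI]; rewrite /unspanned.
have [B /and3P[iB sBX /eqP <-]] := basis_exists (i |: X).
rewrite -cI => /(indep_augment iI iB)[x]; rewrite inE => /andP[xNI xB] ixI.
have /setU1P[<- //|xX] := subsetP sBX _ xB.
have := @card_le_mrank X _ ixI; rewrite subUset sub1set xX sIX => /(_ isT).
by rewrite cardsU1 xNI add1n cI ltnn.
Qed.

Lemma indepU_unspanned X I i :
  is_basis X I -> i \notin I -> i |: I \in indep M -> unspanned X i.
Proof.
move=> /and3P[iI sIX /eqP cI] iNI iiI; rewrite /unspanned.
by rewrite -cI -add1n -[1%N]/(nat_of_bool true) -iNI -cardsU1 card_le_mrank ?setUS.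
Qed.

(** Extend a basis of [X] to one of [Y]: since [i] can be added to the larger basis, it can be added
    to the smaller one. *)
Lemma unspannedS X Y i : X \subset Y -> unspanned Y i -> unspanned X i.
Proof.
move=> sXY uY; have [I bI] := basis_exists X.
have /and3P[iI sIX _] := bI.
have [J bJ sIJ] := basis_extend iI (subset_trans sIX sXY).
apply: (indepU_unspanned bI).
  by apply: contra (unspanned_notin uY); apply/subsetP/(subset_trans sIX).
by apply: indepS (unspanned_indepU bJ uY); apply: setUS.
Qed.

Lemma basisU1 X I i : is_basis X I ->
  is_basis (i |: X) (if unspanned X i then i |: I else I).
Proof.
move=> bI; have /and3P[iI sIX /eqP cI] := bI.
case: ifPn => [uX|]; last first.
  rewrite /unspanned -leqNgt => le; rewrite /is_basis iI.
  rewrite (subset_trans sIX) ?subsetUr //= cI eqn_leq le mrankS //.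
  exact: subsetUr.
have iiI := unspanned_indepU bI uX.
have iNI : i \notin I by apply: contra (unspanned_notin uX); apply/subsetP.
rewrite /is_basis iiI setUS // eqn_leq card_le_mrank ?setUS //=.
rewrite cardsU1 iNI add1n cI.
have [B /and3P[iB sB /eqP <-]] := basis_exists (i |: X).
have := card_le_mrank (indepS (subsetDl B [set i]) iB).
move/(_ X); rewrite subDset sB => /(_ isT) le.
by rewrite -add1n (cardsD1 i B) leq_add // leq_b1.
Qed.

(** If [X] spans [i], then [X :|: I :\ i] has rank at least [#|I|], so a basis of it augments
    [I :\ i], necessarily by an element of [X]. *)
Lemma augment_unspanned X I i : I \in indep M -> i \in I -> ~~ unspanned X i ->
  exists2 x, x \in X :\: (I :\ i) & x |: (I :\ i) \in indep M.
Proof.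
move=> iI iIn nuX.
have iI' : I :\ i \in indep M by apply: indepS iI; apply: subsetDl.
have : ~~ unspanned (X :|: I :\ i) i.
  by apply: contra nuX; apply: unspannedS; apply: subsetUl.
rewrite /unspanned -leqNgt => le.
have := @card_le_mrank (i |: (X :|: I :\ i)) _ iI.
rewrite -{1}(setD1K iIn) setUS ?subsetUr // => /(_ isT).
move=> /leq_trans/(_ le).
have [B /and3P[iB sB /eqP <-]] := basis_exists (X :|: I :\ i).
rewrite (cardsD1 i I) iIn add1n => /(indep_augment iI' iB)[x].
rewrite inE => /andP[xN xB] ix; exists x => //.
rewrite inE xN; have := subsetP sB _ xB.
by rewrite inE (negPf xN) orbF.
Qed.

Section Greedy.
Variables (d : Order.disp_t) (T : orderType d) (key : E -> T).
Hypothesis key_inj : injective key.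

(** Closed form of the greedy algorithm in increasing order of [key]: testing against all earlier
    elements of [X], not only the kept ones, gives the same set and avoids recursion. *)
Definition greedy X :=
  [set i in X | unspanned [set j in X | (key j < key i)%O] i].

Lemma mem_greedy X i : (i \in greedy X) =
  (i \in X) && unspanned [set j in X | (key j < key i)%O] i.
Proof. by rewrite inE. Qed.

(** Induction on the size of [X]: the element [m] of largest key is examined last, so the other
    decisions are those for [X :\ m], and [basisU1] performs the final step. *)
Lemma greedy_basis X : is_basis X (greedy X).
Proof.
have [n] := ubnP #|X|; elim: n X => // n IHn X.
have [->|[i0 i0X]] := set_0Vmem X.
  move=> _; rewrite /is_basis; suff -> : greedy set0 = set0.
    rewrite indep0 sub0set eqn_leq card_le_mrank ?sub0set ?indep0 //=.
    by apply/bigmax_leqP => B /andP[_]; rewrite subset0 => /eqP->.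
  by apply/setP => i; rewrite !inE.
have [m mX maxm] : exists2 m, m \in X & forall j, j \in X -> (key j <= key m)%O.
  by case: (Order.TotalTheory.arg_maxP key i0X) => m mX maxm; exists m.
have maxm' j : j \in X -> (key m < key j)%O = false.
  by move=> jX; rewrite ltNge maxm.
rewrite (cardsD1 m) mX add1n ltnS => /IHn/(@basisU1 _ _ m).
rewrite setD1K //; set G := (X in is_basis _ X); suff -> : G = greedy X by [].
have Xm : [set j in X | (key j < key m)%O] = X :\ m.
  apply/setP => j; rewrite !inE andbC; case: (boolP (j \in X)) => jX; last first.
    by rewrite !andbF.
  by rewrite !andbT lt_neqAle maxm // andbT (inj_eq key_inj).
have Xi i : i \in X -> [set j in X | (key j < key i)%O] =
    [set j in X :\ m | (key j < key i)%O].
  move=> iX; apply/setP => j; rewrite !inE; case: eqP => //= ->.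
  by rewrite maxm' // andbF.
apply/setP => i; have [->|im] := eqVneq i m.
  by rewrite [RHS]inE mX Xm /G; case: ifP => _; rewrite !inE eqxx.
transitivity (i \in greedy (X :\ m)).
  by rewrite /G; case: ifP => // _; rewrite in_setU1 (negPf im).
rewrite !inE im; case: (boolP (i \in X)) => //= iX.
by rewrite Xi.
Qed.

(** [D] is an initial segment of the key order, so the decisions inside [D] never consult elements
    outside it. *)
Lemma greedyI X (D : {set E}) : (forall i j, (key j < key i)%O -> i \in D -> j \in D) ->
  greedy (X :&: D) = greedy X :&: D.
Proof.
move=> Dd; apply/setP => i; rewrite !inE -!andbA; congr (_ && _).
rewrite [RHS]andbC; case: (boolP (i \in D)) => //= iD.
congr unspanned; apply/setP => j; rewrite !inE -andbA; congr (_ && _).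
by case: (boolP (_ < _)%O) => [/Dd/(_ iD)->|]; rewrite ?andbF.
Qed.

End Greedy.
End MatroidRank.

(** * Improving elements are the unsampled candidates *)

Section ImprovingElements.
Variables (R : realFieldType) (E : finType) (M : matroid E) (w : E -> R).
Hypothesis w_ge0 : forall e, 0 <= w e.
Hypothesis w_inj : injective w.
Implicit Types (A B S : {set E}) (i : E).

Lemma wrank_ge A B :
  B \in indep M -> B \subset A -> \sum_(e in B) w e <= wrank M w A.
Proof. by move=> iB sBA; apply: le_bigmax_cond; rewrite iB. Qed.

Lemma wrank_attained A :
  exists2 B, (B \in indep M) && (B \subset A) & wrank M w A = \sum_(e in B) w e.
Proof.
rewrite /wrank; elim/big_ind: _ => [|x y [B hB ->] [D hD ->]|B hB].
- by exists set0; rewrite ?indep0 ?sub0set // big_set0.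
- by case: leP; [exists D | exists B].
- by exists B.
Qed.

Definition candidates S :=
  [set i | (0 < w i) && unspanned M [set j in S | w i < w j] i].

(* Both inclusions are single exchanges: an element spanned by heavier elements
   of [S] can be traded for one of them; an unspanned element either fits in an
   optimal basis of [S] or replaces a lighter element of it. *)
Lemma improving_sub_candidates S : improving M w S \subset candidates S :\: S.
Proof.
apply/subsetP => i; rewrite !inE => lt_i.
have iNS : i \notin S.
  by apply: contraTN lt_i => iS; rewrite (setUidPr _) ?sub1set // ltxx.
rewrite iNS /=; have [B /andP[iB sB] wB] := wrank_attained (i |: S).
have iinB : i \in B.
  apply: contraTT lt_i => iNB; rewrite -leNgt wB wrank_ge //.
  apply/subsetP => x xB; have := subsetP sB _ xB.
  by rewrite !inE => /predU1P[xi|//]; rewrite -xi xB in iNB.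
have sB' : B :\ i \subset S by rewrite subDset.
have iB' : B :\ i \in indep M by apply: indepS iB; apply: subsetDl.
have wBE : wrank M w (i |: S) = w i + \sum_(e in B :\ i) w e.
  by rewrite wB (big_setD1 i).
apply/andP; split.
  rewrite lt_neqAle w_ge0 andbT; apply: contraTneq lt_i => wi.
  by rewrite wBE -wi add0r -leNgt wrank_ge.
apply: contraTT lt_i => /(augment_unspanned iB iinB)[x].
rewrite !inE => /andP[xNB /andP[xS lt_w]] ixB.
rewrite -leNgt wBE; apply: le_trans (wrank_ge ixB _); last first.
  by rewrite subUset sub1set xS.
by rewrite big_setU1 ?inE //= lerD2r ltW.
Qed.

Lemma candidates_sub_improving S : candidates S :\: S \subset improving M w S.
Proof.
apply/subsetP => i; rewrite !inE => /and3P[iNS wi0 ui].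
have [B /andP[iB sB] ->] := wrank_attained S.
have iNB : i \notin B by apply: contra iNS; apply/subsetP.
pose B1 := [set j in B | w i < w j].
have iB1 : B1 \in indep M.
  by apply: indepS iB; apply/subsetP => j; rewrite inE => /andP[].
have bB1 : is_basis M B1 B1.
  rewrite /is_basis iB1 subxx eqn_leq card_le_mrank //=.
  by apply/bigmax_leqP => D /andP[_]; apply: subset_leq_card.
have uB1 : unspanned M B1 i.
  apply: unspannedS ui; apply/subsetP => j; rewrite !inE => /andP[jB ->].
  by rewrite (subsetP sB).
have sB1 : i |: B1 \subset i |: B.
  by apply: setUS; apply/subsetP => j; rewrite inE => /andP[].
have [J bJ sJ] := basis_extend (unspanned_indepU bB1 uB1) sB1.
have /and3P[iJ sJB /eqP cJ] := bJ.
have leBJ : (#|B| <= #|J|)%N by rewrite cJ card_le_mrank // subsetUr.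
apply: lt_le_trans (wrank_ge iJ (subset_trans sJB (setUS _ sB))).
have iJin : i \in J by apply: (subsetP sJ); rewrite setU11.
rewrite (big_setD1 i iJin) /=.
have sJ' : J :\ i \subset B by rewrite subDset.
(* [J] contains [i] and is at least as large as [B], so it drops at most one element of [B]; as it
   keeps [B1], the dropped element is lighter than [i]. *)
have : (#|B :\: (J :\ i)| <= 1)%N.
  rewrite cardsD (setIidPr sJ') leq_subLR addnC.
  by apply: leq_trans leBJ _; rewrite (cardsD1 i J) iJin.
rewrite (big_setID (J :\ i)) /= (setIidPr sJ') [X in _ < X]addrC ltrD2l.
rewrite leq_eqVlt ltnS leqn0 cards_eq0 => /orP[/cards1P[x Dx]|/eqP ->]; last first.
  by rewrite big_set0.
rewrite Dx big_set1.
have : x \in B :\: (J :\ i) by rewrite Dx set11.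
rewrite !inE => /andP[xNJ xB].
have xi : x != i by apply: contraNneq iNB => <-.
rewrite lt_neqAle (inj_eq w_inj) xi /=.
rewrite leNgt; apply: contra xNJ => lt_w; rewrite xi /=.
by apply: (subsetP sJ); rewrite !inE xB lt_w orbT.
Qed.

Lemma improvingE S : improving M w S = candidates S :\: S.
Proof.
by apply/eqP; rewrite eqEsubset improving_sub_candidates candidates_sub_improving.
Qed.
End ImprovingElements.

(** * Expectations and independent coins *)

Section Probability.
Variable R : realFieldType.

Lemma Prob_map (T U : finType) (d : fdist R T) (f : T -> U) (Q : pred U) :
  Prob (fdist_map d f) Q = Prob d (fun x => Q (f x)).
Proof.
rewrite /Prob [RHS](partition_big f Q) //=; apply: eq_bigr => y Qy.
by apply: eq_bigl => x; case: eqP => [->|]; rewrite ?Qy ?andbF.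
Qed.

Lemma Prob_bind (T U : finType) (d : fdist R T) (k : T -> fdist R U)
    (Q : pred U) :
  Prob (fdist_bind d k) Q = \sum_x d x * Prob (k x) Q.
Proof.
by rewrite /Prob /= exchange_big; apply: eq_bigr => x _; rewrite mulr_sumr.
Qed.

Lemma ProbE (T : finType) (d : fdist R T) (Q : pred T) :
  Prob d Q = \sum_x d x * (Q x)%:R.
Proof.
by rewrite /Prob big_mkcond; apply: eq_bigr => x _; case: (Q x); rewrite ?mulr1 ?mulr0.
Qed.

(** Linearity of expectation. *)
Lemma sum_Prob_mem (T E : finType) (d : fdist R T) (X : T -> {set E})
    (F : {set E}) :
  \sum_(i in F) Prob d (fun x => i \in X x) = \sum_x d x * #|X x :&: F|%:R.
Proof.
under eq_bigr do rewrite ProbE.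
rewrite exchange_big; apply: eq_bigr => x _ /=; rewrite -mulr_sumr; congr (_ * _).
rewrite -sum1_card natr_sum big_mkcond [RHS]big_mkcond /=.
by apply: eq_bigr => i _; rewrite inE andbC; case: (i \in F); case: (i \in X x).
Qed.

Section Coin.
Variables (E : finType) (p : R) (p01 : 0 < p < 1).
Variables (i : E) (Q : pred {set E}).
Hypothesis QU1 : forall S, Q (i |: S) = Q (S :\ i).
Let P := random_subset E p01.

Lemma random_subsetU1 (S : {set E}) :
  i \notin S -> (1 - p) * P (i |: S) = p * P S.
Proof.
move=> iNS; rewrite /P /= (bigD1 i) //= [in RHS](bigD1 i) //=.
rewrite setU11 (negPf iNS) mulrCA; congr (_ * (_ * _)).
by apply: eq_bigr => e ei; rewrite !inE (negPf ei).
Qed.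

(** Toggling [i] pairs the samples with and without [i]. By [QU1] the event [Q] is constant on each
    pair, and the two masses are in ratio [p] to [1 - p]. *)
Lemma Prob_coin :
  (1 - p) * Prob P (fun S => (i \in S) && Q S) =
  p * Prob P (fun S => (i \notin S) && Q S).
Proof.
rewrite /Prob !mulr_sumr.
rewrite (reindex_onto (fun S => i |: S) (fun S => S :\ i)) /=; last first.
  by move=> S /andP[iS _]; rewrite setD1K.
apply: eq_big => [S|S /andP[_ /eqP SE]]; last first.
  by apply: random_subsetU1; rewrite -SE !inE eqxx.
rewrite setU11 /= QU1; have [iS|iNS] := boolP (i \in S).
  by rewrite andbC; apply/andP => -[/eqP SE]; rewrite -SE !inE eqxx in iS.
rewrite setU1K // eqxx andbT; congr Q.
by apply/setP => x; rewrite !inE; case: eqP => // ->; rewrite (negPf iNS).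
Qed.

Lemma Prob_coinID : Prob P Q =
  Prob P (fun S => (i \in S) && Q S) + Prob P (fun S => (i \notin S) && Q S).
Proof.
rewrite /Prob (bigID (fun S : {set E} => i \in S)) /=.
by congr (_ + _); apply: eq_bigl => S; rewrite andbC.
Qed.

Lemma Prob_heads : Prob P (fun S => (i \in S) && Q S) = p * Prob P Q.
Proof. by rewrite Prob_coinID mulrDr -Prob_coin -mulrDl addrC subrK mul1r. Qed.

Lemma Prob_tails : Prob P (fun S => (i \notin S) && Q S) = (1 - p) * Prob P Q.
Proof. by rewrite Prob_coinID mulrDr Prob_coin -mulrDl addrC subrK mul1r. Qed.
End Coin.
End Probability.

(** * Expected rank of the improving elements *)

Section RankOfImproving.
Variables (R : realFieldType) (E : finType) (M : matroid E) (w : E -> R).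
Hypothesis w_ge0 : forall e, 0 <= w e.
Hypothesis w_inj : injective w.
Variables (p : R) (p01 : 0 < p < 1) (F : {set E}).
Let P := random_subset E p01.
Let C S := candidates M w S.
Let key (i : E) := - w i.
Let N S := greedy M key (C S :&: F).

Let key_inj : injective key.
Proof. by move=> i j /oppr_inj/w_inj. Qed.

(** Candidacy of [j] consults only sampled elements strictly heavier than [j], and [i] is not one of
    them; the case [j = i] is included. *)
Lemma candidates_coin i j S : w i <= w j -> (j \in C (i |: S)) = (j \in C (S :\ i)).
Proof.
move=> le_w; rewrite !inE; congr (_ && unspanned _ _ _).
apply/setP => k; rewrite !inE; case: eqP => //= ->.
by rewrite ltNge le_w.
Qed.

Lemma greedy_candidates_coin i S : (i \in N (i |: S)) = (i \in N (S :\ i)).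
Proof.
rewrite /N !mem_greedy !in_setI candidates_coin //; congr (_ && unspanned _ _ _).
apply/setP => j; rewrite [LHS]in_set [RHS]in_set !in_setI /key ltrN2.
by case: (ltP (w i) (w j)) => [/ltW/candidates_coin->|]; rewrite ?andbF.
Qed.

(** The sampled candidates form the heaviest-first greedy basis of the positive-weight part of
    [S]. *)
Lemma candidatesI_indep S : C S :&: S \in indep M.
Proof.
have -> : C S :&: S = greedy M key [set i in S | 0 < w i].
  apply/setP => i; rewrite !inE andbC -!andbA; congr (_ && _).
  case: (ltP 0 (w i)) => //= wi; congr unspanned.
  apply/setP => j; rewrite !inE /key ltrN2 -andbA.
  by case: (ltP (w i) (w j)) => [/(lt_trans wi)->|]; rewrite ?andbF.
by have /and3P[] := greedy_basis M key_inj [set i in S | 0 < w i].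
Qed.

(* Elements of [N S] are those of a greedy basis of [C S :&: F], a property that
   does not depend on their own coin: a fraction [1 - p] of them is improving. *)
Lemma expected_mrank_improving :
  p * (\sum_S P S * #|improving M w S :&: F|%:R) <=
  \sum_S P S * (mrank M (improving M w S :&: F))%:R.
Proof.
have P0 S : 0 <= P S by apply: pmf_ge0.
have p1 : 0 <= 1 - p by case/andP: p01 => _ /ltW; rewrite subr_ge0.
have NX S : is_basis M (C S :&: F) (N S) := greedy_basis M key_inj _.
(* [N S :\: S] is an independent set of improving elements of [F]. *)
apply: (@le_trans _ _ (\sum_S P S * #|(N S :\: S) :&: F|%:R)); last first.
  apply: ler_sum => S _; apply: ler_wpM2l => //; rewrite ler_nat.
  have /and3P[iN sN _] := NX S.
  apply: card_le_mrank; first by apply: indepS iN; rewrite subIset // subsetDl.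
  apply: setSI; rewrite improvingE //; apply: setSD.
  by apply: subset_trans sN _; apply: subsetIl.
apply: (@le_trans _ _ ((1 - p) * \sum_S P S * #|N S :&: F|%:R)); last first.
  rewrite -!sum_Prob_mem mulr_sumr; apply: ler_sum => i _.
  rewrite -(Prob_tails p01 (greedy_candidates_coin i)) /Prob le_eqVlt.
  by apply/orP; left; apply/eqP; apply: eq_bigl => S; rewrite [in RHS]inE.
(* [N S] is a basis of [C S :&: F], hence at least as large as this independent subset. *)
apply: (@le_trans _ _ ((1 - p) * \sum_S P S * #|(C S :&: S) :&: F|%:R)); last first.
  apply: ler_wpM2l => //; apply: ler_sum => S _; apply: ler_wpM2l => //.
  have /and3P[_ sN /eqP cN] := NX S.
  rewrite ler_nat (setIidPl (subset_trans sN (subsetIr _ _))) cN card_le_mrank //.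
    by apply: indepS (candidatesI_indep S); apply: subsetIl.
  by apply: setSI; apply: subsetIl.
(* What remains is an equality for each [i]: the coin of [i] does not affect its candidacy, so
   [Prob_coin] trades sampled for unsampled candidates. *)
rewrite -!sum_Prob_mem !mulr_sumr le_eqVlt; apply/orP; left; apply/eqP.
apply: eq_bigr => i _.
transitivity (p * Prob P (fun S => (i \notin S) && (i \in C S))).
  by congr (_ * _); apply: eq_bigl => S; rewrite improvingE // [in LHS]inE.
rewrite -Prob_coin => [|S]; last exact: candidates_coin.
by congr (_ * _); apply: eq_bigl => S; rewrite [in RHS]inE andbC.
Qed.
End RankOfImproving.

(** * Level sets and the theorem of the alternative *)

(** A nonnegative [u] is a nonnegative combination of indicators of its upper level sets; the
    induction peels off the lowest positive level, which shrinks the support. *)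
Lemma sum_levels_ge0 (R : realFieldType) (E : finType) (u y : E -> R) :
  (forall i, 0 <= u i) ->
  (forall t, 0 < t -> 0 <= \sum_(i | t <= u i) y i) ->
  0 <= \sum_i u i * y i.
Proof.
have [n] := ubnP #|[set i | 0 < u i]|; elim: n u => // n IHn u le_n u0 y0.
have [pos0|[i0]] := set_0Vmem [set i | 0 < u i].
  rewrite big1 // => i _; suff -> : u i = 0 by rewrite mul0r.
  apply/eqP; rewrite eq_le u0 andbT leNgt; apply/negP => ui.
  have : i \in set0 by rewrite -pos0 inE.
  by rewrite inE.
rewrite inE => ui0; have [m um minm] :=
  @Order.TotalTheory.arg_minP _ _ _ i0 (fun i => 0 < u i) u ui0.
have uE i : (0 < u i) = (u m <= u i).
  by apply/idP/idP => [/minm//|]; apply: lt_le_trans.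
pose v i := if u m <= u i then u i - u m else 0.
have -> : \sum_i u i * y i = \sum_i v i * y i + u m * \sum_(i | u m <= u i) y i.
  rewrite [X in u m * X]big_mkcond mulr_sumr -big_split /=.
  apply: eq_bigr => i _; rewrite /v -uE; case: ltP => [_|ui].
    by rewrite -mulrDl subrK.
  have -> : u i = 0 by apply/eqP; rewrite eq_le ui u0.
  by rewrite mul0r mulr0 addr0.
apply: addr_ge0; last by apply: mulr_ge0; rewrite // y0.
apply: IHn => [|i|t t0].
- rewrite -ltnS; apply: leq_trans le_n; rewrite ltnS; apply: proper_card.
  apply/properP; split; last by exists m; rewrite !inE // /v lexx subrr ltxx.
  apply/subsetP => i; rewrite !inE /v uE; case: ifP => //; by rewrite ltxx.
- by rewrite /v; case: ifP; rewrite // subr_ge0.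
- rewrite (eq_bigl (fun i => t + u m <= u i)); first by rewrite y0 // addr_gt0.
  move=> i; rewrite /v; case: (leP (u m) (u i)) => h; first by rewrite lerBrDr.
  rewrite leNgt t0 /=; apply/esym/negbTE; rewrite -ltNge.
  by apply: lt_trans h _; rewrite ltrDr.
Qed.

(** Provides the strict gap needed to choose a multiplier in the elimination step of [ville]. *)
Lemma seq_between (R : realFieldType) (m : R) (us : seq R) :
  {in us, forall x, m < x} -> exists2 t, m < t & {in us, forall x, t < x}.
Proof.
elim: us => [_|x us IHus m_lt]; first by exists (m + 1); rewrite ?ltrDl.
have [|t mt tu] := IHus; first by move=> z zu; rewrite m_lt ?inE ?zu ?orbT.
have mx : m < x by rewrite m_lt ?inE ?eqxx.
have [xt|tx] := leP x t; last first.
  by exists t => // z; rewrite inE => /predU1P[->//|/tu].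
have [h1 h2] := midf_lt mx.
exists ((m + x) / 2%:R) => // z; rewrite inE => /predU1P[->//|/tu].
by apply: lt_trans; apply: lt_le_trans xt.
Qed.

(* Ville's theorem of the alternative, by Fourier-Motzkin elimination of one
   coordinate at a time; [C] stands for a convex cone containing [V], and is
   intersected with a half-space at each step. *)
Lemma ville (R : realFieldType) (I : finType) (s : seq I)
    (C : {ffun I -> R} -> Prop) (V : seq {ffun I -> R}) :
  uniq s ->
  (forall v v', C v -> C v' -> C (v + v')) ->
  (forall t v, 0 < t -> C v -> C [ffun i => t * v i]) ->
  {in V, forall v, C v} ->
  (exists2 v, C v & {in s, forall i, 0 <= v i}) \/
  (exists2 u : I -> R, forall i, 0 <= u i &
     {in V, forall v : {ffun I -> R}, \sum_(i <- s) u i * v i < 0}).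
Proof.
elim: s C V => [|i s IHs] C V /=.
  case: V => [|v V] _ _ _ CV; last by left; exists v => //; apply: CV; rewrite mem_head.
  by right; exists (fun=> 0).
move=> /andP[iNs us] CD CZ CV.
pose V0 := [seq v : {ffun I -> R} <- V | 0 <= v i].
pose V1 := [seq v : {ffun I -> R} <- V | v i < 0].
(* Cancels coordinate [i] with the positive multipliers [v i] and [- v' i]. If [v i = 0] the first
   is not positive, and the default [v] keeps the result in the cone. *)
pose comb (v v' : {ffun I -> R}) :=
    if v i == 0 then v else [ffun j => v i * v' j - v' i * v j].
pose W := V0 ++ [seq comb v v' | v <- V0, v' <- V1].
have [|||[v [Cv vi] vs]|[u u0 uW]] := IHs (fun v => C v /\ 0 <= v i) W us.
- by move=> v v' [Cv v0] [Cv' v'0]; split; [exact: CD | rewrite ffunE addr_ge0].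
- move=> t v t0 [Cv v0]; split; first exact: CZ.
  by rewrite ffunE; apply: mulr_ge0 => //; apply: ltW.
- move=> x; rewrite mem_cat => /orP[|/allpairsP[[v v'] /= [hv hv' ->]]].
    by rewrite mem_filter => /andP[v0 /CV].
  move: hv hv'; rewrite !mem_filter => /andP[v0 /CV Cv] /andP[v'0 /CV Cv'].
  rewrite /comb; case: eqP => [//|/eqP vn0]; split.
    have -> : [ffun j => v i * v' j - v' i * v j] =
        [ffun j => v i * v' j] + [ffun j => - v' i * v j].
      by apply/ffunP => j; rewrite !ffunE mulNr.
    by apply: CD; apply: CZ; rewrite ?oppr_gt0 // lt_def vn0.
  by rewrite ffunE [X in X - _]mulrC subrr.
- by left; exists v => // j; rewrite inE => /predU1P[->//|/vs].
pose L (v : {ffun I -> R}) := \sum_(j <- s) u j * v j.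
have L0 v : v \in V0 -> L v < 0 by move=> hv; apply: uW; rewrite mem_cat hv.
have L1 v v' : v \in V0 -> v' \in V1 -> 0 < v i -> v i * L v' - v' i * L v < 0.
  move=> hv hv' v0; have : L (comb v v') < 0.
    by apply: uW; rewrite mem_cat allpairs_f ?orbT.
  rewrite /L /comb gt_eqF // !mulr_sumr -sumrB.
  congr (_ < _); apply: eq_bigr => j _; rewrite ffunE mulrBr.
  by rewrite mulrCA; congr (_ - _); exact: mulrCA.
(* The multiplier [t] of coordinate [i] must exceed [L v / - v i] on [V1] and stay below
   [- L v / v i] on [V0] where [v i > 0]. [L1] makes these bounds compatible, and the default 0
   forces [t > 0]. *)
pose m := \big[Num.max/0]_(v <- V1) (L v / - v i).
have [|t mt tV0] := @seq_between R m [seq - L v / v i | v : {ffun I -> R} <- V0 & 0 < v i].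
  move=> _ /mapP[v + ->]; rewrite mem_filter => /andP[v0 hv].
  rewrite /m big_seq; apply: bigmax_lt => [|v' hv'].
    by rewrite divr_gt0 // oppr_gt0 L0.
   have := hv'; rewrite mem_filter => /andP[v'0 _].
  rewrite ltr_pdivrMr ?oppr_gt0 // mulrAC ltr_pdivlMr //.
  by rewrite mulrNN mulrC -subr_lt0 [X in _ - X]mulrC L1.
have t0 : 0 < t by apply: le_lt_trans mt; apply: bigmax_ge_id.
right; exists (fun j => if j == i then t else u j) => [j|v hv].
  by case: eqP => // _; apply: ltW.
rewrite big_cons eqxx.
have -> : \sum_(j <- s) (if j == i then t else u j) * v j = L v.
  rewrite /L !big_seq; apply: eq_bigr => j js.
  by case: eqP js iNs => // -> ->.
have [v0|v0] := leP 0 (v i); last first.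
  have hv1 : v \in V1 by rewrite mem_filter v0.
  have : L v / - v i < t.
    apply: le_lt_trans mt.
    exact: (@le_bigmax_seq _ _ _ _ _ v xpredT
              (fun v : {ffun I -> R} => L v / - v i)).
  by rewrite ltr_pdivrMr ?oppr_gt0 // mulrN -subr_lt0 opprK addrC.
have hv0 : v \in V0 by rewrite mem_filter v0.
have [->|vn0] := eqVneq (v i) 0; first by rewrite mulr0 add0r L0.
have vp : 0 < v i by rewrite lt_def vn0.
have : t < - L v / v i.
  by apply: tV0; apply/mapP; exists v => //; rewrite mem_filter vp.
by rewrite ltr_pdivlMr // -subr_lt0 opprK.
Qed.

(** * Greedy selection for given prices, and the mixture *)

(** Greedy by decreasing price [u] selects a basis of every upper level set of [u] at once, so the
    rank bound applies to each level and [sum_levels_ge0] combines them. *)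
Lemma greedy_improving (R : realFieldType) (E : finType) (M : matroid E)
    (w : E -> R) (w_ge0 : forall e, 0 <= w e) (w_inj : injective w)
    (p : R) (p01 : 0 < p < 1) (u : E -> R) (u_ge0 : forall i, 0 <= u i) :
  let d := random_improving M w p01 in
  exists2 g : {set E} -> {set E},
    forall A, (g A \in indep M) && (g A \subset A) &
    0 <= \sum_i u i * (Prob d (fun A => i \in g A) - p * Prob d (fun A => i \in A)).
Proof.
(* Prices may tie, unlike weights; the lexicographic second component makes the key injective. *)
pose key i : R *l 'I_#|E| := (- u i, enum_rank i).
have key_inj : injective key by move=> i j [_ /enum_rank_inj].
move=> d; exists (greedy M key) => [A|].
  by have /and3P[-> sA _] := greedy_basis M key_inj A; apply: subset_trans sA _.
apply: sum_levels_ge0 => // t _; pose D := [set i | t <= u i].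
have Dd i j : (key j < key i)%O -> i \in D -> j \in D.
  by rewrite !inE ltxi_pair lerN2 => /andP[le_u _] /le_trans; apply.
have -> (y : E -> R) : \sum_(i | t <= u i) y i = \sum_(i in D) y i.
  by apply: eq_bigl => i; rewrite inE.
rewrite sumrB -mulr_sumr subr_ge0.
under eq_bigr do rewrite Prob_map.
under [X in _ <= X]eq_bigr do rewrite Prob_map.
rewrite !sum_Prob_mem.
apply: le_trans (expected_mrank_improving M w_ge0 w_inj p01 D) _.
rewrite le_eqVlt; apply/orP; left; apply/eqP; apply: eq_bigr => S _.
congr (_ * _%:R); rewrite -greedyI //.
by have /and3P[_ _ /eqP] := greedy_basis M key_inj (improving M w S :&: D).
Qed.

Theorem theorem6 (R : realType) (E : finType) (M : matroid E) (w : E -> R)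
    (w_ge0 : forall e : E, 0 <= w e) (w_inj : injective w)
    (p : R) (p01 : 0 < p < 1) :
  uncontentious M p^-1 (random_improving M w p01).
Proof.
have p0 : 0 < p by case/andP: p01.
set d := random_improving M w p01.
pose T := {ffun {set E} -> {set E}}.
pose valid (a : T) := [forall A, (a A \in indep M) && (a A \subset A)].
(* The slack of each element under the deterministic map [a]; a mixture of valid maps with no
   negative slack is the required [phi]. *)
pose vec (a : T) : {ffun E -> R} :=
  [ffun i => Prob d (fun A => i \in a A) - p * Prob d (fun A => i \in A)].
(* Conic combinations of valid slack vectors; the positive total weight allows normalization to a
   probability distribution. *)
pose C (v : {ffun E -> R}) := exists2 l : T -> R,
  (forall a, 0 <= l a) /\ (forall a, 0 < l a -> valid a) /\ 0 < \sum_a l a &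
  forall i, v i = \sum_a l a * vec a i.
have [|||[v [l [l0 [lv lpos]] vE] v0]|[u u0 uV]] :=
  @ville R E (enum E) C [seq vec a | a in valid] (enum_uniq E).
- move=> v v' [l [l0 [lv lpos]] vE] [l' [l'0 [l'v l'pos]] v'E].
  exists (fun a => l a + l' a) => [|i]; last first.
    by rewrite ffunE vE v'E -big_split; apply: eq_bigr => a _; rewrite mulrDl.
  split=> [a|]; first exact: addr_ge0.
  split=> [a|]; last by rewrite big_split addr_gt0.
  have := l0 a; rewrite le_eqVlt => /predU1P[<-|/lv//].
  by rewrite add0r => /l'v.
- move=> t v t0 [l [l0 [lv lpos]] vE].
  exists (fun a => t * l a) => [|i]; last first.
    by rewrite ffunE vE mulr_sumr; apply: eq_bigr => a _; rewrite mulrA.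
  split=> [a|]; first by apply: mulr_ge0 => //; apply: ltW.
  by split=> [a|]; [rewrite pmulr_rgt0 // => /lv | rewrite -mulr_sumr mulr_gt0].
- move=> _ /mapP[a va ->]; rewrite mem_enum in va.
  have lE (f : T -> R) : \sum_b (b == a)%:R * f b = f a.
    rewrite (bigD1 a) //= eqxx mul1r big1 ?addr0 // => b /negPf->.
    by rewrite mul0r.
  exists (fun b => (b == a)%:R) => [|i]; last by rewrite lE.
  split=> [b|]; first exact: ler0n.
  split=> [b|]; first by case: eqP => [->|_]; rewrite ?ltxx.
  by under eq_bigr do rewrite -[(_ == _)%:R]mulr1; rewrite lE ltr01.
- pose mu a := l a / \sum_b l b.
  have mu0 a : 0 <= mu a by apply: divr_ge0 => //; apply: ltW.
  have mu1 : \sum_a mu a = 1 by rewrite -mulr_suml divff // gt_eqF.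
  pose m := FDist mu0 mu1.
  exists (fun A => fdist_map m (fun a : T => a A)); split=> [A B|i].
    move=> /lt0r_neq0; rewrite /= /Prob.
    have [a /andP[/eqP <- la] _|nex] := pickP (fun a : T => (a A == B) && (0 < l a)).
      by apply/andP; have /forallP/(_ A) := lv a la.
    rewrite big1 ?eqxx // => a aB; have := nex a; rewrite aB /= /mu => nl.
    suff -> : l a = 0 by rewrite mul0r.
    by apply/eqP; rewrite eq_le l0 andbT leNgt nl.
  rewrite ler_pdivlMl // Prob_bind -subr_ge0.
  under eq_bigr do rewrite Prob_map ProbE mulr_sumr.
  rewrite exchange_big /=.
  (* The slack of the mixture is the normalized cone vector, nonnegative by the first
     alternative. *)
  have -> : \sum_a \sum_A d A * (mu a * (i \in (a : T) A)%:R) -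
      p * Prob d (fun A => i \in A) = (\sum_b l b)^-1 * v i.
    rewrite vE [RHS]mulr_sumr -[X in _ - X]mul1r -[X in _ - X * _]mu1.
    rewrite mulr_suml -sumrB.
    apply: eq_bigr => a _; rewrite ffunE /mu.
    rewrite [RHS]mulrA [X in _ = X * _]mulrC [RHS]mulrBr; congr (_ - _).
    rewrite ProbE mulr_sumr.
    by apply: eq_bigr => A _; rewrite mulrCA.
  by apply: mulr_ge0; [rewrite invr_ge0 ltW | apply: v0; rewrite mem_enum].
(* The second alternative gives prices [u] at which every valid map has negative total slack; the
   greedy map for [u] contradicts this. *)
have [g gv] := greedy_improving M w_ge0 w_inj p01 u0.
rewrite leNgt => /negP[]; have /uV : vec [ffun A => g A] \in [seq vec a | a in valid].
  by apply/image_f/forallP => A; rewrite ffunE.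
rewrite big_enum /=; congr (_ < _); apply: eq_bigr => i _.
rewrite ffunE; congr (_ * (_ - _)).
by apply: eq_bigl => A; rewrite ffunE.
Qed.
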